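(* Let $p\geq 2$ and $q\geq 1$ be integers. A graph $G$ is $(p,q)$-biclique-Helly if and only if both of the following hold: (i) every $(p+1,q)$-biexpansion in $G$ has at least $q$ biuniversal vertices; (ii) if $p=2$, then there are no three bicliques $B_1,B_2,B_3$ of $G$, each of cardinality $q$, such that $B_1\cup B_2$, $B_2\cup B_3$ and $B_3\cup B_1$ are bicliques of $G$ but $B_1\cup B_2\cup B_3$ is not a biclique of $G$.
   Context: Graphs are finite, simple and undirected. A graph is complete bipartite if its vertex set can be partitioned into two (possibly empty) stable sets $X,Y$ with every vertex of $X$ adjacent to every vertex of $Y$ (edgeless graphs count as complete bipartite). A biclique of $G$ is a set of vertices inducing a complete bipartite graph; maximal means inclusion-wise maximal. The core of a family of sets is the intersection of its members. A family is $(p,q)$-intersecting if every nonempty subfamily of at most $p$ members has core of cardinality at least $q$, and has the $(p,q)$-Helly property if every nonempty $(p,q)$-intersecting subfamily has core of cardinality at least $q$. A graph is $(p,q)$-biclique-Helly if the family of its maximal bicliques has the $(p,q)$-Helly property. In a graph whose vertices each carry one of two labels, two different vertices are bicompatible if they are adjacent with different labels or nonadjacent with the same label; a vertex is biuniversal if it is bicompatible with every other vertex. Let $\mathcal D$ be a family of $p+1$ pairwise different bicliques of $G$, each of cardinality $q$, whose union $U$ is a biclique of $G$, and let $\{X,Y\}$ be the unique bipartition of $G[U]$ with $X,Y$ stable and $X$ complete to $Y$. The $(p+1,q)$-biexpansion of $\mathcal D$ in $G$ is the subgraph of $G$ induced by those vertices $v$ such that $P\cup\{v\}$ is a biclique for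 some union $P$ of $p$ pairwise different members of $\mathcal D$, where each such $v$ is labeled $X$ or $Y$ as follows: if $v\in X$ (resp. $v\in Y$) it is labeled $X$ (resp. $Y$), and if $v\notin U$ it is given the label that makes it bicompatible with every vertex of such a $P$ (this label does not depend on the choice of $P$). *)

(* Defs.v *)
From mathcomp Require Import all_boot.

Set Implicit Arguments.
Unset Strict Implicit.
Unset Printing Implicit Defensive.

Section SetFamilies.
Variable T : finType.
Implicit Types F : {set {set T}}.

(* For F = set0 this is the full set; it is only used for nonempty F. *)
Definition core F : {set T} := \bigcap_(B in F) B.

Definition pq_intersecting (p q : nat) F : Prop :=
  forall F', F' \subset F -> F' != set0 -> #|F'| <= p -> q <= #|core F'|.

Definition pq_Helly (p q : nat) F : Prop :=
  forall F', F' \subset F -> F' != set0 ->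
    pq_intersecting p q F' -> q <= #|core F'|.

End SetFamilies.

(* A simple graph on the vertex type T is given by its adjacency relation e,
   which is assumed symmetric and irreflexive where graphs are quantified. *)
Section Bicliques.
Variables (T : finType) (e : rel T).
Implicit Types (u v : T) (S X Y B : {set T}) (D C : {set {set T}}).

Definition stable S : bool := [forall u in S, forall v in S, ~~ e u v].

Definition complete_to X Y : bool := [forall u in X, forall v in Y, e u v].

(* X or Y may be empty, so stable sets are bicliques. *)
Definition bipartition S X Y : bool :=
  [&& X :|: Y == S, [disjoint X & Y], stable X, stable Y & complete_to X Y].

Definition biclique S : bool :=
  [exists X : {set T}, exists Y : {set T}, bipartition S X Y].

Definition maximal_bicliques : {set {set T}} := [set B | maxset biclique B].

Definition biclique_Helly (p q : nat) : Prop :=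
  pq_Helly p q maximal_bicliques.

(* u carries the label a and v the label b. *)
Definition bicompatible u (a : bool) v (b : bool) : bool :=
  (u != v) && (e u v && (a != b) || ~~ e u v && (a == b)).

(* The set of biuniversal vertices of the subgraph induced by W, whose
   vertices are labeled by l. *)
Definition biuniversal (W : {set T}) (l : T -> bool) : {set T} :=
  [set v in W | [forall u in W, (u != v) ==> bicompatible v (l v) u (l u)]].

Definition biexpandable (p q : nat) D : bool :=
  [&& #|D| == p.+1, [forall B in D, biclique B && (#|B| == q)]
    & biclique (cover D)].

(* cover C is a union P of p pairwise different members of D such that
   P together with v is a biclique. *)
Definition attaches (p : nat) D v C : bool :=
  [&& C \subset D, #|C| == p & biclique (v |: cover C)].

Definition biexp_vertices (p : nat) D : {set T} :=
  [set v | [exists C, attaches p D v C]].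

(* The label X is encoded as true and Y as false, where X is one side of the
   bipartition of cover D (the other side being cover D :\: X).  A vertex v
   outside cover D gets the label X exactly when this label makes it
   bicompatible with every vertex of some P as above.  When 2 <= p, 1 <= q and
   biexpandable p q D hold, exactly one of the two labels does this for a given
   v and P (P is a nonempty biclique), and it does not depend on P (two such
   unions share a nonempty member of D). *)
Definition biexp_label (p : nat) D X v : bool :=
  if v \in cover D then v \in X
  else [exists C, attaches p D v C &&
          [forall u in cover C, bicompatible v true u (u \in X)]].

End Bicliques.

(* Main.v *)
(* A set is a biclique iff the adjacencies inside it are [e x y = f x (+) f y]
   for some labelling [f] by booleans, iff every three of its vertices span an
   even number of edges.  Given a biexpansion, consider the maximal bicliques
   containing a union of [p] members of [D]: any [p] of them share a member of
   [D], so by the Helly property their core has [q] elements, and these are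
   biuniversal.  Conversely, let [G] be a minimal violation of the Helly property,
   and for [p + 1] members of [G] take [q] elements in the core of the family
   without that member.  These sets form a biexpandable family, each set of [G]
   contains [p] of them, and a biuniversal vertex belongs to every set of [G] by
   maximality, which contradicts the violation. *)
Require Import Defs.
From mathcomp Require Import all_boot.

Set Implicit Arguments.
Unset Strict Implicit.
Unset Printing Implicit Defensive.

Lemma subset_of_card (T : finType) (A : {set T}) (k : nat) :
  k <= #|A| -> exists2 B : {set T}, B \subset A & #|B| = k.
Proof.
move=> le_kA; have : 0 < #|[set B : {set T} | B \subset A & #|B| == k]|.
  by rewrite cards_draws bin_gt0.
by case/card_gt0P=> B; rewrite inE => /andP[sBA /eqP]; exists B.
Qed.

(** * Helly-type arguments in families of finite sets *)

Section SetFamilies.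
Variable T : finType.
Implicit Types (F D C : {set {set T}}) (A B M : {set T}).

Lemma sub_core F M : M \in F -> core F \subset M.
Proof. exact: bigcap_inf. Qed.

Lemma cover_subP D A :
  reflect (forall B, B \in D -> B \subset A) (cover D \subset A).
Proof. exact: bigcupsP. Qed.

Lemma cover_sup D B : B \in D -> B \subset cover D.
Proof. exact: bigcup_sup. Qed.

Lemma cover_sub C D : C \subset D -> cover C \subset cover D.
Proof.
by move=> /subsetP sCD; apply/cover_subP => B /sCD; apply: cover_sup.
Qed.

Definition catching (p : nat) F D : {set {set T}} :=
  [set M in F | [exists C : {set {set T}},
     [&& C \subset D, #|C| == p & cover C \subset M]]].

(* Each set of the subfamily omits at most one member of [D], so at most [p]
   sets leave some member of [D] inside all of them. *)
Lemma Helly_core_catching (p q : nat) F D :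
    pq_Helly p q F -> #|D| = p.+1 -> (forall B, B \in D -> q <= #|B|) ->
  catching p F D != set0 -> q <= #|core (catching p F D)|.
Proof.
move=> hellyF cardD Dq ne0; apply: hellyF => //.
  by apply/subsetP => M; rewrite inE => /andP[].
move=> F' /subsetP sF' _ leF'p.
have [/existsP[B /andP[BD /forall_inP BF']] | noB] :=
    boolP [exists B, (B \in D) && [forall M in F', B \subset M]].
  exact: leq_trans (Dq B BD) (subset_leq_card (introT bigcapsP BF')).
(* For [B] in [D], [g B] is a set of [F'] that omits [B]; the default is never reached, since no
   member of [D] lies in all of [F']. *)
pose g B := odflt set0 [pick M in F' | ~~ (B \subset M)].
have gP B : B \in D -> (g B \in F') /\ ~~ (B \subset g B).
  move=> BD; rewrite /g; case: pickP => [M /andP[] // | none].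
  case/negP: noB; apply/existsP; exists B; rewrite BD.
  by apply/forall_inP => M MF'; have /negbT := none M; rewrite MF' negbK.
have g_inj : {in D &, injective g}.
  move=> B1 B2 B1D B2D eq_g; have [gF' ng1] := gP _ B1D.
  have [_ ng2] := gP _ B2D; rewrite -eq_g in ng2.
  have := sF' _ gF'; rewrite inE => /andP[_ /existsP[C /and3P[sCD /eqP Cp]]].
  move=> /cover_subP sC.
  have /eqP/cards1P[B0 DC] : #|D :\: C| = 1 by rewrite cardsDS // cardD Cp subSnn.
  have inDC B : B \in D -> ~~ (B \subset g B1) -> B = B0.
    move=> BD nB; apply/set1P; rewrite -DC inE BD andbT.
    by apply: contra nB; apply: sC.
  by rewrite (inDC _ B1D) // (inDC _ B2D).
have : #|D| <= #|F'|.
  rewrite -(card_in_imset g_inj); apply/subset_leq_card/subsetP => M.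
  by case/imsetP => B BD ->; case: (gP _ BD).
by rewrite cardD leqNgt ltnS leF'p.
Qed.

(* In a minimal subfamily violating the conclusion of the Helly property, every
   member [N] can be dropped to bring the core back to at least [q] elements;
   [f N] consists of [q] of them. *)
Lemma Helly_minimal_violation (p q : nat) F :
    0 < p -> F != set0 -> pq_intersecting p q F -> #|core F| < q ->
  exists (G S : {set {set T}}) (f : {set T} -> {set T}),
    [/\ G \subset F, #|core G| < q, S \subset G, #|S| = p.+1
      & forall N, N \in S ->
          #|f N| = q /\ (forall M, M \in G -> M != N -> f N \subset M)].
Proof.
move=> p_gt0 F_ne0 intF coreF.
pose viol (G : {set {set T}}) := (G != set0) && (#|core G| < q).
have [|G minG sGF] := @minset_exists _ viol F; first by rewrite /viol F_ne0.
have /minsetP[/andP[G_ne0 coreG] minG'] := minG.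
have G_gt : p < #|G|.
  by rewrite ltnNge; apply/negP => /(intF _ sGF G_ne0); rewrite leqNgt coreG.
have [S sSG Sp] := subset_of_card G_gt.
(* [G :\ N] is nonempty because [G] has more than [p >= 1] sets, so minimality of [G] keeps it from
   being a violation. *)
have drop N : N \in G -> q <= #|core (G :\ N)|.
  move=> NG; have ne0 : G :\ N != set0.
    by rewrite -card_gt0 -(ltn_add2l (N \in G)) -cardsD1 NG (leq_ltn_trans p_gt0).
  rewrite leqNgt; apply/negP => viol'.
  have eqG := minG' (G :\ N) (introT andP (conj ne0 viol')) (subD1set _ _).
  by move: NG; rewrite -eqG !inE eqxx.
pose f N := odflt set0 [pick B : {set T} | B \subset core (G :\ N) & #|B| == q].
exists G, S, f; split=> // N /(subsetP sSG) NG; rewrite /f.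
case: pickP => [B /andP[sB /eqP Bq] | none].
  split=> // M MG neq_MN; apply: (subset_trans sB).
  by apply: sub_core; rewrite !inE neq_MN.
have [B sB Bq] := subset_of_card (drop N NG).
by have := none B; rewrite sB Bq eqxx.
Qed.

End SetFamilies.

(** * Bicliques through labellings and the parity of triples *)

Section Bicliques.
Variables (T : finType) (e : rel T).
Hypotheses (e_sym : symmetric e) (e_irr : irreflexive e).
Implicit Types (u v x y : T) (S X Y B M : {set T}) (D C : {set {set T}}).

Lemma bipartition_adj S X Y :
  bipartition e S X Y -> {in S &, forall x y, e x y = (x \in X) (+) (y \in X)}.
Proof.
case/and5P=> /eqP <- dXY /forall_inP stX /forall_inP stY /forall_inP cXY.
have YX x : x \in Y -> x \in X = false by apply: disjointFl.
move=> x y /setUP[] xS /setUP[] yS.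
- by rewrite xS yS; exact: negbTE (forall_inP (stX x xS) y yS).
- by rewrite xS (YX y) //; exact: forall_inP (cXY x xS) y yS.
- by rewrite yS (YX x) // e_sym; exact: forall_inP (cXY y yS) x xS.
by rewrite !YX //; exact: negbTE (forall_inP (stY x xS) y yS).
Qed.

Lemma labelling_biclique S (f : T -> bool) :
  {in S &, forall x y, e x y = f x (+) f y} -> biclique e S.
Proof.
move=> ef; apply/existsP; exists [set x in S | f x].
apply/existsP; exists [set x in S | ~~ f x]; apply/and5P; split.
- by apply/eqP/setP => x; rewrite !inE -andb_orr orbN andbT.
- by rewrite -setI_eq0; apply/eqP/setP => x; rewrite !inE; case: (f x); rewrite ?andbF.
all: apply/forall_inP => x /[!inE] /andP[xS fx].
all: apply/forall_inP => y /[!inE] /andP[yS fy].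
all: by move: fx fy; rewrite ef //; case: (f x); case: (f y).
Qed.

(* Three vertices of a complete bipartite graph span an even number of edges,
   and this characterizes complete bipartite graphs. *)
Lemma biclique_tripleP S :
  reflect {in S & &, forall x y z, e x y (+) e y z = e x z} (biclique e S).
Proof.
apply: (iffP idP) => [/existsP[X /existsP[Y /bipartition_adj eX]] | tr].
  by move=> x y z xS yS zS; rewrite !eX //; case: (x \in X); case: (y \in X); case: (z \in X).
have [-> | [x0 x0S]] := set_0Vmem S.
  by apply: (@labelling_biclique _ xpredT) => x; rewrite inE.
(* The label of a vertex is its adjacency to the fixed [x0]; the triple [x], [x0], [y] gives the
   rule for the edge. *)
by apply: (@labelling_biclique _ (e x0)) => x y xS yS; rewrite (e_sym x0 x) tr.
Qed.

Lemma biclique_sub S S' : S \subset S' -> biclique e S' -> biclique e S.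
Proof.
move=> /subsetP sSS' /biclique_tripleP tr; apply/biclique_tripleP.
by move=> x y z /sSS' xS /sSS' yS /sSS' zS; apply: tr.
Qed.

Lemma maximal_biclique_sup S :
  biclique e S -> exists2 M, M \in maximal_bicliques e & S \subset M.
Proof. by case/maxset_exists=> M maxM sSM; exists M; rewrite ?inE. Qed.

Lemma maximal_bicliqueW M : M \in maximal_bicliques e -> biclique e M.
Proof. by rewrite inE => /maxsetp. Qed.

Lemma bicompatibleE u a v b :
  bicompatible e u a v b = (u != v) && (e u v == a (+) b).
Proof. by rewrite /bicompatible; case: (e u v) a b => [] [] []. Qed.

(** * The labelling of a biexpansion *)

Section Biexpansion.
Variables (p q : nat) (D : {set {set T}}) (X Y : {set T}).
Hypotheses (p_ge2 : 2 <= p) (q_ge1 : 1 <= q).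
Hypotheses (expD : biexpandable e p q D) (XY : bipartition e (cover D) X Y).
Local Notation label := (biexp_label e p D X).

Lemma biexpandable_member B : B \in D -> #|B| = q.
Proof. by case/and3P: expD => _ /forall_inP Dq _ /Dq/andP[_ /eqP]. Qed.

(** Two [p]-subsets of a set of [p + 1] elements meet because [p + 1 < 2 * p], and [1 <= q] makes
    the shared member of [D] nonempty. Its vertices transport labels from one union to another. *)
Lemma biexpandable_common C C' :
    C \subset D -> #|C| = p -> C' \subset D -> #|C'| = p ->
  exists2 x, x \in cover C & x \in cover C'.
Proof.
move=> sCD Cp sC'D C'p; case/and3P: (expD) => /eqP Dp _ _.
have /card_gt0P[B /setIP[BC BC']] : 0 < #|C :&: C'|.
  have leD : #|C :|: C'| <= p.+1.
    by rewrite -Dp; apply: subset_leq_card; rewrite subUset sCD.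
  by rewrite cardsI Cp C'p subn_gt0 (leq_ltn_trans leD) // -[p.+2]add2n leq_add2r.
have /card_gt0P[x xB] : 0 < #|B| by rewrite (biexpandable_member (subsetP sCD B BC)).
by exists x; apply/bigcupP; exists B.
Qed.

(** This is the independence of the label from the chosen union: a vertex common to two unions ties
    them together by the parity of triples. *)
Lemma attaches_adj v C : attaches e p D v C ->
  {in cover C, forall x, e v x = label v (+) (x \in X)}.
Proof.
move=> /[dup] att /and3P[sCD /eqP Cp /biclique_tripleP triC] x xC.
have sU := subsetP (cover_sub sCD); have xU := sU x xC.
have eX := bipartition_adj XY; rewrite /biexp_label.
case: ifP => [vU | vU]; first exact: eX.
case: existsP => [[C' /andP[/and3P[sC'D /eqP C'p _] /forall_inP bic]] | noC'].
  have [x0 x0C x0C'] := biexpandable_common sCD Cp sC'D C'p.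
  have := bic _ x0C'; rewrite bicompatibleE => /andP[_ /eqP e0].
  rewrite -(triC v x0 x) ?setU11 ?setU1r // e0 (eX x0 x) ?sU //.
  by case: (x0 \in X); case: (x \in X).
(* The label [true] fails for every union, so for [C] it fails at some [u]. Hence [false] is right
   at [u], and the triple [v], [u], [x] carries this over to [x]. *)
have /forall_inPn[u uC] : ~~ [forall u in cover C, bicompatible e v true u (u \in X)].
  by apply/negP => bic; apply: noC'; exists C; rewrite att.
have neq_vu : v != u by apply: contraFneq vU => ->; apply: sU.
rewrite bicompatibleE neq_vu /= => evu.
rewrite -(triC v u x) ?setU11 ?setU1r // (eX u x) ?sU //.
by move: evu; case: (e v u); case: (u \in X); case: (x \in X).
Qed.

(** One vertex of [cover C] relates both labels to adjacency, and the parity of the triple through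
    it decides the edge between [u] and [v]. *)
Lemma attaches_adj2 u v C : #|C| = p -> C \subset D ->
  biclique e (u |: (v |: cover C)) -> e u v = label u (+) label v.
Proof.
move=> Cp sCD bic.
have [x xC _] := biexpandable_common sCD Cp sCD Cp.
have attu : attaches e p D u C.
  by rewrite /attaches sCD Cp eqxx (biclique_sub _ bic) // setUS // subsetUr.
have attv : attaches e p D v C.
  by rewrite /attaches sCD Cp eqxx (biclique_sub _ bic) // subsetUr.
have := biclique_tripleP _ bic u x v.
rewrite !inE !eqxx xC !orbT => /(_ isT isT isT) <-.
rewrite (attaches_adj attu) // e_sym (attaches_adj attv) //.
by case: (label u); case: (label v); case: (x \in X).
Qed.

(** A union of [p] members and a vertex attached to it extend to a maximal biclique, which contains
    every core vertex. All of them thus lie in one biclique, where labels agree with adjacency. *)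
Lemma core_catching_sub_biuniversal :
  core (catching p (maximal_bicliques e) D)
    \subset biuniversal e (biexp_vertices e p D) label.
Proof.
have attM u C : attaches e p D u C ->
    exists2 M, M \in catching p (maximal_bicliques e) D & u |: cover C \subset M.
  case/and3P=> sCD Cp /maximal_biclique_sup[M maxM sM]; exists M => //.
  rewrite inE maxM; apply/existsP; exists C; rewrite sCD Cp.
  by apply: subset_trans sM; apply: subsetUr.
have bic_core v u C : v \in core (catching p (maximal_bicliques e) D) ->
    attaches e p D u C -> biclique e (v |: (u |: cover C)).
  move=> vF /attM[M MF sM]; apply: (@biclique_sub _ M).
    by rewrite subUset sub1set sM (subsetP (sub_core MF)).
  by move: MF; rewrite inE => /andP[/maximal_bicliqueW].
have [C0 sC0 C0p] : exists2 C : {set {set T}}, C \subset D & #|C| = p.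
  by case/and3P: expD => /eqP Dp _ _; apply: subset_of_card; rewrite Dp.
have bicC0 : biclique e (cover C0).
  by case/and3P: expD => _ _; apply: biclique_sub; apply: cover_sub.
have [x0 x0C0 _] := biexpandable_common sC0 C0p sC0 C0p.
(* A vertex of [cover C0] attaches to [C0] trivially; through it [bic_core] places [v] in the
   biexpansion. *)
have att0 : attaches e p D x0 C0.
  by rewrite /attaches sC0 C0p eqxx (setUidPr _) // sub1set.
apply/subsetP => v vF; rewrite !inE; apply/andP; split.
  apply/existsP; exists C0; rewrite /attaches sC0 C0p eqxx /=.
  by apply: biclique_sub (bic_core _ _ _ vF att0); rewrite setUS // subsetUr.
apply/forall_inP => u /[!inE] /existsP[C att]; apply/implyP => neq_uv.
rewrite bicompatibleE eq_sym neq_uv (@attaches_adj2 v u C) ?eqxx //.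
- by case/and3P: att => _ /eqP.
- by case/and3P: att.
exact: bic_core.
Qed.

(** All of [M] lies in the biexpansion, with labels that agree with adjacency. Adding a biuniversal
    vertex preserves this agreement, so maximality absorbs the vertex into [M]. *)
Lemma biuniversal_sub_maximal M :
    M \in catching p (maximal_bicliques e) D ->
  biuniversal e (biexp_vertices e p D) label \subset M.
Proof.
rewrite inE => /andP[maxM /existsP[C /and3P[sCD /eqP Cp sCM]]].
have bicM := maximal_bicliqueW maxM.
have adjM : {in M &, forall u v, e u v = label u (+) label v}.
  move=> u v uM vM; apply: (@attaches_adj2 u v C) => //.
  by apply: biclique_sub bicM; rewrite !subUset !sub1set uM vM.
have MW : {in M, forall u, u \in biexp_vertices e p D}.
  move=> u uM; rewrite inE; apply/existsP; exists C.
  rewrite /attaches sCD Cp eqxx (biclique_sub _ bicM) //.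
  by rewrite subUset sub1set uM.
apply/subsetP => z /[!inE] /andP[_ /forall_inP bz].
have adjz : {in M, forall u, e z u = label z (+) label u}.
  move=> u uM; have [-> | neq_uz] := eqVneq u z; first by rewrite e_irr addbb.
  have := bz u (MW u uM); rewrite neq_uz /= bicompatibleE.
  by case/andP=> _ /eqP.
suff bicMz : biclique e (z |: M).
  move: maxM; rewrite inE => /maxsetsup/(_ bicMz (subsetUr _ _)) <-.
  exact: setU11.
apply: (@labelling_biclique _ label) => u v /setU1P[-> | uM] /setU1P[-> | vM].
- by rewrite e_irr addbb.
- exact: adjz.
- by rewrite e_sym adjz // addbC.
exact: adjM.
Qed.

End Biexpansion.

(** * Three bicliques with compatible pairs, and the converse implication *)

(** The maximal bicliques containing pairwise unions have a common vertex [v] by the Helly property.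
    Adjacency to [v] labels the whole union, since any two of its vertices lie in one pairwise
    union. *)
Lemma Helly_union3 (q : nat) B1 B2 B3 :
    1 <= q -> biclique_Helly e 2 q -> #|B1| = q -> #|B2| = q -> #|B3| = q ->
    biclique e (B1 :|: B2) -> biclique e (B2 :|: B3) ->
  biclique e (B3 :|: B1) -> biclique e (B1 :|: B2 :|: B3).
Proof.
move=> q_ge1 helly q1 q2 q3 b12 b23 b31; apply: contraT => nb.
(* Two equal sets would reduce the triple union to a pairwise one. *)
have n12 : B1 != B2.
  by apply: contra nb => /eqP eqB; rewrite eqB setUid.
have n23 : B2 != B3.
  by apply: contra nb => /eqP eqB; rewrite -eqB -setUA setUid.
have n31 : B3 != B1.
  by apply: contra nb => /eqP eqB; rewrite eqB setUAC setUid.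
pose D := [set B1; B2; B3].
have D1 : B1 \in D by rewrite !inE eqxx.
have D2 : B2 \in D by rewrite !inE eqxx orbT.
have D3 : B3 \in D by rewrite !inE eqxx !orbT.
have cardD : #|D| = 3.
  by rewrite /D -setUA cardsU1 cards2 !inE negb_or n12 n23 eq_sym n31.
have caught B B' : B \in D -> B' \in D -> B != B' -> biclique e (B :|: B') ->
    exists2 M, M \in catching 2 (maximal_bicliques e) D & B :|: B' \subset M.
  move=> BD B'D neqB /maximal_biclique_sup[M maxM sM]; exists M => //.
  rewrite inE maxM; apply/existsP; exists [set B; B'].
  rewrite cards2 neqB subUset !sub1set BD B'D; apply/cover_subP => A.
  move: sM; rewrite subUset => /andP[sB sB'].
  by rewrite !inE => /orP[] /eqP ->.
have : q <= #|core (catching 2 (maximal_bicliques e) D)|.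
  apply: Helly_core_catching => //.
    by move=> B; rewrite !inE -orbA => /or3P[] /eqP ->; rewrite ?q1 ?q2 ?q3.
  by apply/set0Pn; have [M MF _] := caught _ _ D1 D2 n12 b12; exists M.
move=> /(leq_trans q_ge1)/card_gt0P[v vF].
have adj B B' x y : B \in D -> B' \in D -> B != B' -> biclique e (B :|: B') ->
    x \in B :|: B' -> y \in B :|: B' -> e x y = e v x (+) e v y.
  move=> BD B'D neqB bBB' xB yB.
  have [M MF /subsetP sM] := caught _ _ BD B'D neqB bBB'.
  have vM := subsetP (sub_core MF) v vF.
  move: MF; rewrite inE => /andP[/maximal_bicliqueW/biclique_tripleP tr _].
  by rewrite (e_sym v x) tr // sM.
case/negP: nb; apply: (@labelling_biclique _ (e v)) => x y.
rewrite !in_setU -!orbA => xB yB.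
have [xy12 | xy23 | xy31] :
    [\/ (x \in B1 :|: B2) && (y \in B1 :|: B2),
        (x \in B2 :|: B3) && (y \in B2 :|: B3)
      | (x \in B3 :|: B1) && (y \in B3 :|: B1)].
  rewrite !in_setU; case/or3P: xB => ->; case/or3P: yB => ->;
  rewrite ?orbT; by [constructor 1 | constructor 2 | constructor 3].
- by case/andP: xy12; apply: adj.
- by case/andP: xy23; apply: adj.
- by case/andP: xy31; apply: adj.
Qed.

Lemma Helly_of_biexpansion (p q : nat) :
    2 <= p -> 1 <= q ->
    (forall D X Y, biexpandable e p q D -> bipartition e (cover D) X Y ->
       q <= #|biuniversal e (biexp_vertices e p D) (biexp_label e p D X)|) ->
    (p = 2 -> forall B1 B2 B3, #|B1| = q -> #|B2| = q -> #|B3| = q ->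
       biclique e (B1 :|: B2) -> biclique e (B2 :|: B3) ->
       biclique e (B3 :|: B1) -> biclique e (B1 :|: B2 :|: B3)) ->
  biclique_Helly e p q.
Proof.
move=> p_ge2 q_ge1 biuniv union3 F sFmax F_ne0 intF; rewrite leqNgt.
apply/negP => coreF; have p_gt0 := ltnW p_ge2.
have [G [S [f [sGF coreG sSG Sp fP]]]] :=
  Helly_minimal_violation p_gt0 F_ne0 intF coreF.
have Gmax M : M \in G -> M \in maximal_bicliques e.
  by move=> /(subsetP sGF)/(subsetP sFmax).
have fq N : N \in S -> #|f N| = q by case/fP.
have f_sub N M : N \in S -> M \in G -> M != N -> f N \subset M.
  by case/fP=> _; apply.
(* A common value of [f] at two different members would lie in every set of [G], giving the core [q]
   elements. *)
have f_inj : {in S &, injective f}.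
  move=> N1 N2 N1S N2S eqf; apply: contraTeq coreG => neqN.
  rewrite -leqNgt -(fq N1 N1S); apply/subset_leq_card/bigcapsP => M MG.
  have [-> | neqM] := eqVneq M N1; last exact: f_sub.
  by rewrite eqf; apply: f_sub => //; apply: (subsetP sSG).
have bicM M (A : {set T}) : M \in G -> A \subset M -> biclique e A.
  by move=> /Gmax/maximal_bicliqueW bM sAM; apply: biclique_sub bM.
(* For [p = 2] the three vertices may come from all the members of the family,
   which is the case that [union3] takes care of. *)
have bicU : biclique e (cover (f @: S)).
  apply/biclique_tripleP => x y z.
  move=> /bigcupP[_ /imsetP[N1 N1S ->] xN1] /bigcupP[_ /imsetP[N2 N2S ->] yN2].
  move=> /bigcupP[_ /imsetP[N3 N3S ->] zN3].
  suff /biclique_tripleP : biclique e (f N1 :|: f N2 :|: f N3).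
    by apply; rewrite !inE ?xN1 ?yN2 ?zN3 ?orbT.
  (* A member of [S] other than [N1], [N2], [N3] is a biclique containing all three sets. Otherwise
     [p + 1 <= 3], so the three are distinct and [p = 2]. *)
  have [S123 | /subsetPn[M MS]] := boolP (S \subset [set N1; N2; N3]); last first.
    rewrite !inE !negb_or -andbA => /and3P[MN1 MN2 MN3].
    have MG := subsetP sSG M MS.
    by apply: (bicM M) => //; rewrite !subUset !f_sub.
  have [n12 n13 n23 p_le2] : [/\ N1 != N2, N1 != N3, N2 != N3 & p <= 2].
    have := subset_leq_card S123.
    rewrite Sp -setUA cardsU1 cards2 !inE negb_or => le_p.
    have := leq_trans (p_ge2 : 2 < p.+1) le_p; move: le_p.
    by case: (N1 != N2); case: (N1 != N3); case: (N2 != N3).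
  have p2 : p = 2 by apply/eqP; rewrite eqn_leq p_le2.
  have pair N N' M : N \in S -> N' \in S -> M \in S -> M != N -> M != N' ->
      biclique e (f N :|: f N').
    move=> NS N'S /(subsetP sSG) MG MN MN'; apply: (bicM M) => //.
    by rewrite subUset !f_sub.
  apply: union3; rewrite ?fq //.
  - by apply: (pair _ _ N3); rewrite // eq_sym.
  - exact: (pair _ _ N1).
  - by apply: (pair _ _ N2); rewrite // eq_sym.
have expD : biexpandable e p q (f @: S).
  rewrite /biexpandable card_in_imset // Sp eqxx bicU andbT /=.
  apply/forall_inP => _ /imsetP[N NS ->]; rewrite fq // eqxx andbT.
  by apply: biclique_sub bicU; apply: cover_sup; apply: imset_f.
have /existsP[X /existsP[Y XY]] := bicU.
have := biuniv _ _ _ expD XY; apply/negP; rewrite -ltnNge.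
apply: leq_ltn_trans coreG; apply/subset_leq_card/bigcapsP => M MG.
apply: (biuniversal_sub_maximal p_ge2 q_ge1 expD XY); rewrite inE Gmax //=.
(* Whether or not [M] is in [S], at least [p] of the [p + 1] members of [S] differ from [M], and
   their images under [f] lie inside [M]. *)
have [C sC Cp] : exists2 C : {set {set T}}, C \subset S :\ M & #|C| = p.
  apply: subset_of_card; rewrite -ltnS -Sp (cardsD1 M S).
  by case: (M \in S).
have sCS := subset_trans sC (subD1set S M).
apply/existsP; exists (f @: C); rewrite imsetS //= card_in_imset ?Cp ?eqxx /=.
  apply/cover_subP => _ /imsetP[N NC ->].
  have := subsetP sC N NC; rewrite !inE eq_sym => /andP[neqM NS].
  exact: f_sub.
by move=> N N' /(subsetP sCS) NS /(subsetP sCS); apply: f_inj.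
Qed.

End Bicliques.

Theorem theorem4p7 (T : finType) (e : rel T)
    (e_sym : symmetric e) (e_irr : irreflexive e)
    (p q : nat) (p_ge2 : 2 <= p) (q_ge1 : 1 <= q) :
  biclique_Helly e p q <->
  (forall (D : {set {set T}}) (X Y : {set T}),
      biexpandable e p q D -> bipartition e (cover D) X Y ->
      q <= #|biuniversal e (biexp_vertices e p D) (biexp_label e p D X)|) /\
  (p = 2 ->
     ~ exists B1 B2 B3 : {set T},
         [/\ biclique e B1, biclique e B2 & biclique e B3] /\
         [/\ #|B1| = q, #|B2| = q & #|B3| = q] /\
         [/\ biclique e (B1 :|: B2), biclique e (B2 :|: B3)
           & biclique e (B3 :|: B1)] /\
         ~~ biclique e (B1 :|: B2 :|: B3)).
Proof.
split=> [helly | [biuniv no_triple]].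
  split=> [D X Y expD XY | p2 [B1 [B2 [B3 [_ [[q1 q2 q3] [[b12 b23 b31] /negP]]]]]]].
    apply: leq_trans (subset_leq_card
      (core_catching_sub_biuniversal e_sym p_ge2 q_ge1 expD XY)).
    have /and3P[/eqP Dp /forall_inP Dq bicU] := expD.
    apply: Helly_core_catching => //.
      by move=> B /Dq/andP[_ /eqP ->].
    have [C sCD Cp] : exists2 C : {set {set T}}, C \subset D & #|C| = p.
      by apply: subset_of_card; rewrite Dp.
    (* A maximal biclique above [cover D] contains every union of [p] members, so the catching
       family is nonempty. *)
    have [M maxM sM] := maximal_biclique_sup bicU; apply/set0Pn; exists M.
    rewrite inE maxM; apply/existsP; exists C; rewrite sCD Cp eqxx /=.
    exact: subset_trans (cover_sub sCD) sM.
  by apply; apply: (Helly_union3 e_sym q_ge1) => //; rewrite -p2.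
apply: Helly_of_biexpansion => // p2 B1 B2 B3 q1 q2 q3 b12 b23 b31.
apply: contraT => nb; case: (no_triple p2); exists B1, B2, B3; do !split=> //.
- by apply: (biclique_sub e_sym _ b12); apply: subsetUl.
- by apply: (biclique_sub e_sym _ b12); apply: subsetUr.
by apply: (biclique_sub e_sym _ b23); apply: subsetUr.
Qed.
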